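(* Let $\mathrm{PoF}_n$ denote the price of MMS with respect to egalitarian welfare for allocating contiguous blocks of goods to $n$ agents. Then $\mathrm{PoF}_n=\Theta(n)$; that is, there are absolute constants $c,C>0$ such that $c\,n\le \mathrm{PoF}_n\le C n$ for every integer $n\ge 3$.
   Context: A fair-goods instance $\mathcal I=\langle N,E,\mathcal V\rangle$ consists of agents $N=\{1,\dots,n\}$, indivisible items $E=\{e_1,\dots,e_m\}$ placed on a path in this order, and for each agent $i$ an additive valuation $v_i$ (i.e. $v_i(S)=\sum_{e\in S}v_i(e)$) with $v_i(e)\ge 0$ for all $e\in E$, normalized so that $v_i(\emptyset)=0$, $v_i(E)=1$. A bundle is connected if it is a set of consecutive items (the empty set is allowed). An allocation $\mathbf A=(A_1,\dots,A_n)$ is a partition of $E$ into $n$ pairwise disjoint connected (possibly empty) bundles, $A_i$ being given to agent $i$ (the left-to-right order of the agents' bundles is arbitrary). Its egalitarian welfare is $\mathsf{EW}(\mathbf A)=\min_{i\in N}v_i(A_i)$; $\mathsf{OPT}_E(\mathcal I)$ is the maximum of $\mathsf{EW}$ over all allocations of $\mathcal I$. The maximin share of agent $i$ is $\mathsf{MMS}_i(\mathcal I)=\max_{\mathbf X}\min_{j\in[n]}v_i(X_j)$, the maximum over all partitions $\mathbf X=(X_1,\dots,X_n)$ of $E$ into $n$ connected (possibly empty) bundles. An allocation $\mathbf A$ is MMS fair if $v_i(A_i)\ge \mathsf{MMS}_i(\mathcal I)$ for all $i\in N$. The price of fairness is $\mathrm{PoF}_n=\sup_{\mathcal I}\min_{\mathbf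 A}\frac{\mathsf{OPT}_E(\mathcal I)}{\mathsf{EW}(\mathbf A)}$, the supremum over all fair-goods instances with $n$ agents (any number of items) and the minimum over all MMS fair allocations $\mathbf A$ of $\mathcal I$; conventions: $c/0=+\infty$ for $c>0$ and $0/0=1$. *)

(* Defs.v *)
From HB Require Import structures.
From mathcomp Require Import all_boot all_order all_algebra.
From mathcomp Require Import boolp classical_sets reals ereal.

Set Implicit Arguments.
Unset Strict Implicit.
Unset Printing Implicit Defensive.

Import Order.TTheory GRing.Theory Num.Theory.
Local Open Scope ring_scope.

Record instance (R : realType) (n : nat) := Instance {
  nitems : nat;
  val : 'I_n -> 'I_nitems -> R;
  val_ge0 : forall i e, 0 <= val i e;
  val_sum1 : forall i, \sum_(e < nitems) val i e = 1
}.

Section FairDivision.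
Context {R : realType} {n : nat}.
Variable I : instance R n.

Definition bundle := {set 'I_(nitems I)}.

Definition bundle_val (i : 'I_n) (S : bundle) : R := \sum_(e in S) val i e.

Definition connected (S : bundle) : bool :=
  [exists a : 'I_(nitems I).+1, exists b : 'I_(nitems I).+1,
     S == [set e : 'I_(nitems I) | (a <= e < b)%N]%SET].

(* Serves both as an allocation (A i goes to agent i) and as a partition
   into n unassigned parts. *)
Definition is_allocation (A : {ffun 'I_n -> bundle}) : bool :=
  [&& [forall i, connected (A i)],
      [forall i, forall j, (i != j) ==> [disjoint A i & A j]]
    & (\bigcup_(i < n) A i)%SET == [set: 'I_(nitems I)]%SET].

(* Bundle values lie in [0, 1] by normalization, so for n > 0 the initial
   values 1 of the minima and 0 of the maxima do not affect the result. *)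
Definition EW (A : {ffun 'I_n -> bundle}) : R :=
  \big[Num.min/1]_(i < n) bundle_val i (A i).

Definition OPT : R :=
  \big[Num.max/0]_(A : {ffun 'I_n -> bundle} | is_allocation A) EW A.

Definition MMS (i : 'I_n) : R :=
  \big[Num.max/0]_(X : {ffun 'I_n -> bundle} | is_allocation X)
    \big[Num.min/1]_(j < n) bundle_val i (X j).

Definition mms_fair (A : {ffun 'I_n -> bundle}) : bool :=
  [forall i, MMS i <= bundle_val i (A i)].

Definition ratio (x y : R) : \bar R :=
  if y == 0 then (if x == 0 then 1%E else +oo%E) else (x / y)%:E.

Definition instance_price : \bar R :=
  \big[Order.min/+oo%E]_(A : {ffun 'I_n -> bundle}
                          | is_allocation A && mms_fair A) ratio OPT (EW A).

End FairDivision.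

Definition PoF (R : realType) (n : nat) : \bar R :=
  ereal_sup (range (@instance_price R n)).

(* Main.v *)
(* Upper bound. Let c = OPT / 2n. Cutting greedily, an agent all of whose items
   in her optimal bundle are worth less than c would get n blocks worth c out
   of that bundle, so an agent whose maximin share is below c has in her
   optimal bundle a single item worth at least c. These items are distinct;
   each such agent is content with hers, and the other agents want their
   maximin share, which is at least c. A left-to-right sweep that always serves
   the agent whose next acceptable block ends first satisfies everybody, since
   each step costs every other agent at most one block of her maximin partition.

   Lower bound. Two agents value one item at nearly 1 and about n/2 others at
   1/n^2 each. For the other n - 2 agents these small items are worth 1/n each,
   and the remaining items 1/2n each, two of which make up the maximin share
   1/n. Maximin fairness leaves at most 2/n of their value to the first two
   agents, so one of those gets at most 2/n^2; giving all the small items to one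
   of them and single remaining items to the others achieves 1/3n. *)
Require Import Defs.
From HB Require Import structures.
From mathcomp Require Import all_boot all_order all_algebra.
From mathcomp Require Import boolp classical_sets reals ereal.
From mathcomp Require Import zify ring lra.

Set Implicit Arguments.
Unset Strict Implicit.
Unset Printing Implicit Defensive.

Import Order.TTheory GRing.Theory Num.Theory.
Local Open Scope ring_scope.

(** * Greedy cutting and the left-to-right sweep, on bare positions *)

Section Sweep.
Local Open Scope nat_scope.

(** Acceptability of the half-open block from [x] to [y], stable under enlarging the block on either
    side. This covers both value thresholds and the demand for one given item. *)
Definition block_test (ok : rel nat) :=
  [/\ forall x y, ok x y -> x <= y,
      forall x x' y, x <= x' -> ok x' y -> ok x y
    & forall x y y', y <= y' -> ok x y -> ok x y'].

(* [m.+1] when no block starting at [x] and ending by [m] passes the test. *)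
Definition first_end (m : nat) (ok : rel nat) (x : nat) : nat :=
  find (ok x) (iota 0 m.+1).

Lemma first_end_ub m ok x : first_end m ok x <= m.+1.
Proof. by rewrite -[m.+1](size_iota 0) find_size. Qed.

Lemma first_end_ok m (ok : rel nat) x :
  first_end m ok x <= m -> ok x (first_end m ok x).
Proof.
move=> le_m; have lt_m : first_end m ok x < m.+1 by [].
rewrite -[X in ok x X](nth_iota 0 0 lt_m).
by apply: nth_find; rewrite has_find size_iota.
Qed.

Lemma first_end_le m (ok : rel nat) x y :
  ok x y -> y <= m -> first_end m ok x <= y.
Proof.
move=> okxy le_ym; rewrite leqNgt; apply/negP => /(before_find 0).
by rewrite nth_iota // add0n okxy.
Qed.

Lemma first_end_min m (ok : rel nat) x y :
  y < first_end m ok x -> ok x y = false.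
Proof.
move=> lty; apply/negP => okxy.
have /(first_end_le okxy) : y <= m by have := first_end_ub m ok x; lia.
lia.
Qed.

Lemma first_end_mono m (ok : rel nat) : block_test ok ->
  {homo first_end m ok : x y / x <= y}.
Proof.
move=> [_ okl _] x y lexy.
have [le_m|] := leqP (first_end m ok y) m.
  by apply: first_end_le => //; apply: okl lexy _; apply: first_end_ok.
by apply: leq_trans; apply: first_end_ub.
Qed.

Lemma iter_first_end_mono m (ok : rel nat) k : block_test ok ->
  {homo iter k (first_end m ok) : x y / x <= y}.
Proof.
move=> okP x y lexy; elim: k => //= k IHk; exact: (first_end_mono m okP IHk).
Qed.

(** The overflow value [m.+1] is absorbing: a successful last step certifies that all earlier ones
    succeeded. *)
Lemma iter_first_end_le m (ok : rel nat) k y : block_test ok ->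
  iter k (first_end m ok) y <= m -> y <= m.
Proof.
move=> [okle _ _]; elim: k => //= k IHk le_m; apply: IHk.
exact: leq_trans (okle _ _ (first_end_ok le_m)) le_m.
Qed.

(** Greedy stays ahead: its first block ends no later than the given block with the smallest end, so
    all other given blocks remain to its right. *)
Lemma greedy_blocks (T : finType) m (ok : rel nat) (lo hi : T -> nat)
    (S : {set T}) x :
    block_test ok -> x <= m ->
    (forall i, i \in S -> [/\ x <= lo i, lo i < hi i, hi i <= m
                            & ok (lo i) (hi i)]) ->
    (forall i j, i \in S -> j \in S -> i != j ->
       hi i <= lo j \/ hi j <= lo i) ->
  iter #|S| (first_end m ok) x <= m.
Proof.
move=> okP; have [okle okl okr] := okP.
move: {2}#|S| (erefl #|S|) => k; elim: k S x => [|k IHk] S x cardS lexm SP disjS.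
  by rewrite cardS.
have /set0Pn [i0 i0S] : S != finset.set0 by rewrite -card_gt0 cardS.
case: (arg_minnP hi i0S) => i iS_ hi_min; have iS : i \in S := iS_.
have cardSi : #|S :\ i| = k by move: (cardsD1 i S); rewrite iS cardS => -[].
have [lexi ltii leim oki] := SP _ iS.
rewrite cardS iterSr.
have le_fe : first_end m ok x <= hi i by apply: first_end_le => //; apply: okl oki.
rewrite -cardSi; apply: IHk => //; first exact: leq_trans le_fe leim.
  move=> j /setD1P [neji jS]; have [lexj ltjj lejm okj] := SP _ jS; split=> //.
  have := hi_min _ jS; case: (disjS _ _ iS jS _); rewrite 1?eq_sym //; lia.
by move=> j j' /setD1P [_ jS] /setD1P [_ j'S]; apply: disjS.
Qed.

(* Agents in [P] insist on the single item [g i], the others have room for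
   [#|S|] greedy blocks to the right of [x]. Serving the agent whose next block
   ends first, members of [P] winning ties, preserves this invariant. *)
Lemma sweep (T : finType) m (ok : T -> rel nat) (P : pred T) (g : T -> nat)
    (S : {set T}) x :
    (forall i, block_test (ok i)) ->
    (forall i a b, P i -> ok i a b = (a <= g i < b)) ->
    (forall i j, P i -> P j -> g i = g j -> i = j) ->
    S != finset.set0 -> x <= m ->
    (forall i, i \in S -> P i -> x <= g i < m) ->
    (forall i, i \in S -> ~~ P i -> iter #|S| (first_end m (ok i)) x <= m) ->
  exists lo hi : T -> nat,
    [/\ forall i, i \in S -> [/\ x <= lo i, hi i <= m & ok i (lo i) (hi i)],
        forall i j, i \in S -> j \in S -> i != j ->
          hi i <= lo j \/ hi j <= lo i
      & forall e, x <= e < m -> exists2 i, i \in S & lo i <= e < hi i].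
Proof.
move=> okP okg g_inj; move: {2}#|S|.-1 (erefl #|S|.-1) => k.
have endg y i : P i -> y <= g i < m -> first_end m (ok i) y = (g i).+1.
  move=> Pi gi; apply/eqP; rewrite eqn_leq first_end_le ?okg //; try lia.
  rewrite ltnNge; apply/negP => le_g.
  have /first_end_ok : first_end m (ok i) y <= m by lia.
  rewrite okg //; lia.
elim: k S x => [|k IHk] S x cardS Sn0 lexm Sg Sfe.
  have /eqP/cards1P [i Si] : #|S| = 1%N by rewrite -card_gt0 in Sn0; lia.
  have iS : i \in S by rewrite Si set11.
  (* The last agent takes everything that is left, so the blocks cover all positions. *)
  exists (fun=> x), (fun=> m); split.
  - move=> j; rewrite Si => /set1P ->; split=> //.
    have [Pi|nPi] := boolP (P i); first by rewrite okg ?Sg.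
    have [_ _ okr] := okP i; have := Sfe _ iS nPi; rewrite Si cards1 /= => le_m.
    exact: okr le_m (first_end_ok le_m).
  - by move=> j j'; rewrite Si => /set1P -> /set1P ->; rewrite eqxx.
  - by move=> e xe; exists i.
have [i0 i0S] := set0Pn _ Sn0.
(* Doubling the end leaves room for a last bit that breaks ties in favour of [P]. *)
pose key i := (first_end m (ok i) x).*2 + ~~ P i.
case: (arg_minnP key i0S) => i iS_ key_min; have iS : i \in S := iS_.
have cardSk : #|S| = k.+2 by lia.
have cardSi : #|S :\ i| = k.+1 by move: (cardsD1 i S); rewrite iS cardSk => -[].
set y := first_end m (ok i) x.
have leym : y <= m.
  have [Pi|nPi] := boolP (P i); first by rewrite /y endg ?Sg //; have := Sg _ iS Pi; lia.
  by have := Sfe _ iS nPi; rewrite cardSk iterSr; apply: iter_first_end_le.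
have oki : ok i x y := first_end_ok leym.
have lexy : x <= y by have [okle _ _] := okP i; apply: okle.
have [|||||lo [hi [okA disjA covA]]] := IHk (S :\ i) y.
- by rewrite cardSi.
- by rewrite -card_gt0 cardSi.
- exact: leym.
(* The item [g j] is not swallowed: that would force a tie of ends, which the key excludes if [i] is
   outside [P] and injectivity of [g] excludes otherwise. *)
- move=> j /setD1P [neji jS] Pj.
  have gj := Sg _ jS Pj; have := key_min _ jS; rewrite /key -/y (endg x j) // Pj.
  have [Pi|nPi] := boolP (P i); last lia.
  have gi := Sg _ iS Pi.
  have : g i <> g j by move=> /(g_inj _ _ Pi Pj) eij; rewrite eij eqxx in neji.
  rewrite /y endg //; lia.
(* Since [y] is at most the first end of [j], agent [j] loses at most one greedy block. *)
- move=> j /setD1P [neji jS] nPj; rewrite cardSi.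
  have := Sfe _ jS nPj; rewrite cardSk iterSr; apply: leq_trans.
  apply: iter_first_end_mono => //.
  by have := key_min _ jS; rewrite /key -/y nPj; case: (P i); lia.
have Sj j : j \in S -> j != i -> j \in S :\ i by move=> *; apply/setD1P.
exists (fun j => if j == i then x else lo j),
       (fun j => if j == i then y else hi j); split.
- move=> j jS; have [-> //|ji] := eqVneq j i.
  have [? ? ?] := okA _ (Sj _ jS ji); split=> //; lia.
- move=> j j' jS j'S; have [->|ji] := eqVneq j i.
    rewrite eq_sym; have [//|j'i _] := eqVneq j' i.
    by left; have [] := okA _ (Sj _ j'S j'i).
  have [_ _|j'i jj'] := eqVneq j' i; first by right; have [] := okA _ (Sj _ jS ji).
  by apply: disjA; rewrite // Sj.
- move=> e xe; have [ltey|leye] := ltnP e y.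
    by exists i; rewrite // eqxx; lia.
  have [|j /setD1P [ji jS] ej] := covA e; first lia.
  by exists j; rewrite // (negbTE ji).
Qed.

End Sweep.

(** * Allocations as families of blocks, and elementary bounds on values *)

Definition block (m a b : nat) : {set 'I_m} :=
  [set e : 'I_m | (a <= e < b)%N]%SET.

Section Allocations.
Context {R : realType} {n : nat}.
Implicit Types (I : instance R n) (i j : 'I_n).

Lemma in_block m a b (e : 'I_m) : (e \in block m a b) = (a <= e < b)%N.
Proof. by rewrite inE. Qed.

Lemma connected_block I a b : Defs.connected (block (nitems I) a b).
Proof.
have lt_m k : (minn k (nitems I) < (nitems I).+1)%N by lia.
apply/existsP; exists (Ordinal (lt_m a)); apply/existsP; exists (Ordinal (lt_m b)).
by apply/eqP/setP => e; rewrite !inE /=; have := ltn_ord e; lia.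
Qed.

Lemma allocation_of_blocks I (lo hi : 'I_n -> nat) :
    (forall i j, i != j -> (hi i <= lo j \/ hi j <= lo i)%N) ->
    (forall e, (e < nitems I)%N -> exists i, (lo i <= e < hi i)%N) ->
  @is_allocation R n I [ffun i => block (nitems I) (lo i) (hi i)].
Proof.
move=> disj cov; apply/and3P; split.
- by apply/forallP => i; rewrite ffunE connected_block.
- apply/forallP => i; apply/forallP => j; apply/implyP => ij; rewrite !ffunE.
  apply/pred0Pn => -[e /andP [/=]]; rewrite !in_block.
  by case: (disj _ _ ij); lia.
- apply/eqP/setP => e; rewrite !inE; apply/bigcupP.
  by have [i ei] := cov e (ltn_ord e); exists i; rewrite // ffunE in_block.
Qed.

(** An empty bundle may have endpoints anywhere, even in reversed order, so disjointness is kept at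
    the level of sets. *)
Lemma blocks_of_allocation I A : @is_allocation R n I A ->
  exists lo hi : 'I_n -> nat,
    [/\ forall i, (hi i <= nitems I)%N,
        forall i, A i = block (nitems I) (lo i) (hi i)
      & forall i j, i != j -> [disjoint A i & A j]].
Proof.
case/and3P => /forallP conn /forallP disj _.
have ex i : {p : nat * nat | (p.2 <= nitems I)%N & A i = block (nitems I) p.1 p.2}.
  apply: cid2; have /existsP [a /existsP [b /eqP ->]] := conn i.
  by exists (val a, val b) => //=; rewrite -ltnS.
exists (fun i => (s2val (ex i)).1), (fun i => (s2val (ex i)).2); split=> i.
- exact: (s2valP (ex i)).
- exact: (s2valP' (ex i)).
- by move=> j; apply/implyP; have /forallP := disj i; apply.
Qed.

Lemma bundle_val_ge0 I i S : 0 <= @bundle_val R n I i S.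
Proof. by apply: sumr_ge0 => e _; apply: val_ge0. Qed.

Lemma bundle_val_sub I i (S1 S2 : bundle I) :
  S1 \subset S2 -> @bundle_val R n I i S1 <= bundle_val i S2.
Proof.
move=> sub; rewrite /bundle_val [leRHS](big_setID S1) /= (finset.setIidPr sub).
by rewrite lerDl sumr_ge0 // => e _; apply: val_ge0.
Qed.

Lemma bundle_val_le1 I i S : @bundle_val R n I i S <= 1.
Proof.
rewrite -(val_sum1 I i) /bundle_val [leRHS](bigID (fun e => e \in S)) /=.
by rewrite lerDl sumr_ge0 // => e _; apply: val_ge0.
Qed.

Lemma val_le_bundle I i (S : bundle I) (e : 'I_(nitems I)) :
  e \in S -> Defs.val i e <= @bundle_val R n I i S.
Proof.
move=> eS; rewrite /bundle_val (big_setD1 e) //= lerDl.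
by rewrite sumr_ge0 // => e' _; apply: val_ge0.
Qed.

Lemma bundle_val_cat I i a b c : (a <= b <= c)%N ->
  bundle_val i (block (nitems I) a c) =
  bundle_val i (block (nitems I) a b) + bundle_val i (block (nitems I) b c).
Proof.
move=> abc; rewrite /bundle_val (big_setID (block (nitems I) a b)) /=.
congr (_ + _); apply: eq_bigl => e; rewrite !inE; lia.
Qed.

Lemma le_EW I (A : {ffun 'I_n -> bundle I}) c :
  c <= 1 -> (forall i, c <= bundle_val i (A i)) -> c <= EW A.
Proof. by move=> c1 cA; apply: le_bigmin. Qed.

Lemma EW_le I (A : {ffun 'I_n -> bundle I}) i : EW A <= bundle_val i (A i).
Proof. exact: bigmin_le_cond. Qed.

Lemma EW_le1 I (A : {ffun 'I_n -> bundle I}) : EW A <= 1.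
Proof. exact: bigmin_le_id. Qed.

Lemma EW_ge0 I (A : {ffun 'I_n -> bundle I}) : 0 <= EW A.
Proof. by apply: le_EW => // i; apply: bundle_val_ge0. Qed.

Lemma OPT_le1 I : OPT I <= 1.
Proof. by apply: bigmax_le => // A _; apply: EW_le1. Qed.

Lemma OPT_ge0 I : 0 <= OPT I.
Proof. exact: bigmax_ge_id. Qed.

Lemma EW_le_OPT I A : @is_allocation R n I A -> EW A <= OPT I.
Proof. by move=> alloc; apply: le_bigmax_cond. Qed.

Lemma le_MMS I i X c : @is_allocation R n I X -> c <= 1 ->
  (forall j, c <= bundle_val i (X j)) -> c <= MMS I i.
Proof.
move=> alloc c1 cX; rewrite /MMS; apply: (bigmax_sup X) => //.
exact: le_bigmin.
Qed.

(** Carries a property from the candidates and the default 0 to [MMS] or [OPT], without choosing a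
    maximizer. *)
Lemma bigmax_closed (P : R -> Prop) (T : finType) (Q : pred T) (F : T -> R) :
  P 0 -> (forall t, Q t -> P (F t)) -> P (\big[Num.max/0]_(t | Q t) F t).
Proof.
move=> P0 PF; apply: big_ind => // x y Px Py.
by have [] := leP x y.
Qed.

(** * Maximin shares through greedy cutting, and the upper bound *)

(** The conjunct [a <= b] matters when [c <= 0], where a reversed, hence empty, block would reach
    the threshold. *)
Definition worth I i (c : R) : rel nat :=
  fun a b => (a <= b)%N && (c <= bundle_val i (block (nitems I) a b)).

Lemma block_sub m a b a' b' : (a' <= a)%N -> (b <= b')%N ->
  block m a b \subset block m a' b'.
Proof. by move=> aa bb; apply/fintype.subsetP => e; rewrite !in_block; lia. Qed.

Lemma block_test_worth I i c : block_test (worth I i c).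
Proof.
split=> [x y /andP [] // | x x' y xx /andP [xy le_c] | x y y' yy /andP [xy le_c]].
  rewrite /worth (leq_trans xx xy) (le_trans le_c) //.
  by apply: bundle_val_sub; apply: block_sub.
rewrite /worth (leq_trans xy yy) (le_trans le_c) //.
by apply: bundle_val_sub; apply: block_sub.
Qed.

(** The parts of a maximin partition are [n] disjoint acceptable blocks, and greedy cutting does at
    least as well. *)
Lemma MMS_greedy I i :
  (iter n (first_end (nitems I) (worth I i (MMS I i))) 0 <= nitems I)%N.
Proof.
set m := nitems I; apply: (bigmax_closed (P := fun c =>
  (iter n (first_end m (worth I i c)) 0 <= m)%N)) => [|X allocX].
  rewrite (@iter_fix _ _ _ 0%N) //; apply/eqP; rewrite -leqn0.
  by apply: first_end_le => //; rewrite /worth leqnn bundle_val_ge0.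
set c := \big[_/_]_(j < n) _.
have cX j : c <= bundle_val i (X j) by apply: bigmin_le_cond.
have c_ge0 : 0 <= c by apply: le_bigmin => // j _; apply: bundle_val_ge0.
have [c_le0|c_gt0] := leP c 0.
  (* Here the empty block at 0 already passes, so 0 is a fixed point; for positive [c] the parts are
     nonempty. *)
  rewrite (@iter_fix _ _ _ 0%N) //; apply/eqP; rewrite -leqn0.
  by apply: first_end_le => //; rewrite /worth leqnn (le_trans c_le0) ?bundle_val_ge0.
have [lo [hi [him XE disj]]] := blocks_of_allocation allocX.
have ne j : (lo j < hi j)%N.
  rewrite ltnNge; apply/negP => hilo; have := cX j; rewrite XE /bundle_val big_pred0 => [|e].
    by rewrite leNgt c_gt0.
  by rewrite in_block; lia.
have -> : n = #|[set: 'I_n]%SET| by rewrite cardsT card_ord.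
apply: (@greedy_blocks _ _ _ lo hi) => //; first exact: block_test_worth.
  move=> j _; split; rewrite ?ne ?him // /worth ltnW ?ne //= -/m -XE; exact: cX.
move=> j k _ _ jk; have := disj _ _ jk; rewrite !XE => /pred0P dis.
have lo_m j' : (lo j' < m)%N by exact: leq_trans (ne j') (him j').
have := dis (Ordinal (lo_m j)); have := dis (Ordinal (lo_m k)).
rewrite /= !in_block /=; have := ne j; have := ne k; lia.
Qed.

(** Converse of [MMS_greedy]: the sweep among [n] copies of the same agent, none insisting on an
    item, completes the greedy blocks to a partition. *)
Lemma greedy_MMS I i c : (0 < n)%N -> c <= 1 ->
  (iter n (first_end (nitems I) (worth I i c)) 0 <= nitems I)%N -> c <= MMS I i.
Proof.
move=> n_gt0 c1 fit.
have [|||||||lo [hi [okA disj cov]]] :=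
  @sweep _ (nitems I) (fun=> worth I i c) pred0 (fun=> 0%N) [set: 'I_n]%SET 0 => //.
- by move=> _; apply: block_test_worth.
- by rewrite -card_gt0 cardsT card_ord.
- by rewrite cardsT card_ord.
pose X := [ffun j => block (nitems I) (lo j) (hi j)].
have allocX : @is_allocation R n I X.
  apply: allocation_of_blocks => [j k jk|e em]; first by apply: disj; rewrite ?inE.
  by have [] := cov e em; move=> j _; exists j.
apply: (le_MMS allocX c1) => j; rewrite ffunE.
by have [_ _ /andP []] := okA j (finset.in_setT _).
Qed.

(* Each greedy block costs less than [2 * c], the last item included. *)
Lemma small_items_greedy I i c a b k : 0 < c -> (a <= b <= nitems I)%N ->
    (forall e : 'I_(nitems I), (a <= e < b)%N -> Defs.val i e < c) ->
    2 * k%:R * c <= bundle_val i (block (nitems I) a b) ->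
  (iter k (first_end (nitems I) (worth I i c)) a <= b)%N.
Proof.
move=> c_gt0; elim: k a => [|k IHk] a ab small le_val; first by case/andP: ab.
pose V x y := bundle_val i (block (nitems I) x y).
rewrite iterSr; set y := first_end (nitems I) _ a.
have okab : worth I i c a b.
  rewrite /worth; case/andP: ab => -> _ /=; apply: le_trans le_val.
  have : 0 <= k%:R * c by rewrite mulr_ge0 // ltW.
  by rewrite -[k.+1]addn1 natrD; lra.
have leyb : (y <= b)%N by apply: first_end_le => //; lia.
have leym : (y <= nitems I)%N by lia.
have /andP [leay cV] : worth I i c a y := first_end_ok leym.
have ltay : (a < y)%N.
  rewrite ltn_neqAle leay andbT; apply/eqP => ay; move: cV.
  rewrite -ay /bundle_val big_pred0 => [|e]; last by rewrite in_block; lia.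
  by rewrite leNgt c_gt0.
have Vprev : V a y.-1 < c.
  have : worth I i c a y.-1 = false by apply: (@first_end_min (nitems I)); rewrite -/y; lia.
  by rewrite /worth (_ : (a <= y.-1)%N) /=; [rewrite leNgt => /negbFE | lia].
have lty : (y.-1 < nitems I)%N by lia.
have Vlast : V y.-1 y < c.
  rewrite /V /bundle_val (big_pred1 (Ordinal lty)) => [|e].
    by apply: small => /=; lia.
  by rewrite in_block; apply/idP/eqP => [ye|->] /=; [apply: ord_inj => /=|]; lia.
have Vay : V a y = V a y.-1 + V y.-1 y by apply: bundle_val_cat; lia.
have Vab : V a b = V a y + V y b by apply: bundle_val_cat; lia.
apply: IHk; first lia.
  by move=> e ey; apply: small; lia.
by move: le_val; rewrite -!/(V _ _) -[k.+1]addn1 natrD; lra.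
Qed.

(* With [c = OPT / 2n], an agent whose maximin share is below [c] has an item
   of value at least [c] in her optimal bundle, and is content with it. *)
Lemma fair_allocation I : (0 < n)%N ->
  exists A, [/\ @is_allocation R n I A, mms_fair A & OPT I <= 2 * n%:R * EW A].
Proof.
move=> n_gt0; set m := nitems I; set c := OPT I / (2 * n%:R).
have n2_gt0 : 0 < 2 * n%:R :> R by rewrite mulr_gt0 // ltr0n.
have c_le1 : c <= 1.
  rewrite ler_pdivrMr // mul1r (le_trans (OPT_le1 I)) //.
  have : 1 <= n%:R :> R by rewrite ler1n.
  lra.
have c_ge0 : 0 <= c by rewrite divr_ge0 ?OPT_ge0 // ltW.
have cE : 2 * n%:R * c = OPT I by rewrite mulrC divfK // gt_eqF.
pose P i := MMS I i < c.
have [lo [hi [him optV disj]]] : exists lo hi : 'I_n -> nat,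
    [/\ forall i, (lo i <= hi i <= m)%N,
        forall i, OPT I <= bundle_val i (block m (lo i) (hi i))
      & forall i j, i != j -> [disjoint block m (lo i) (hi i) & block m (lo j) (hi j)]].
  apply: (bigmax_closed (P := fun z => exists lo hi : 'I_n -> nat,
    [/\ forall i, (lo i <= hi i <= m)%N,
        forall i, z <= bundle_val i (block m (lo i) (hi i))
      & forall i j, i != j -> [disjoint block m (lo i) (hi i) & block m (lo j) (hi j)]])).
    (* The default 0 of the maximum is realized by empty blocks. *)
    exists (fun=> 0%N), (fun=> 0%N); split=> // [i|i j _]; first exact: bundle_val_ge0.
    by apply/pred0P => e; rewrite /= !in_block; lia.
  move=> A allocA; have [lo [hi [him AE disj]]] := blocks_of_allocation allocA.
  have AE' i : A i = block m (minn (lo i) (hi i)) (hi i).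
    by rewrite AE; apply/setP => e; rewrite !in_block; lia.
  exists (fun i => minn (lo i) (hi i)), hi; split=> [i|i|i j ij].
  - by have := him i; rewrite -/m; lia.
  - by rewrite -AE'; apply: EW_le.
  - by rewrite -!AE'; apply: disj.
have exg i : exists e : nat, P i ->
    exists2 f : 'I_m, val f = e & (f \in block m (lo i) (hi i)) && (c <= Defs.val i f).
  have [Pi|nPi] := boolP (P i); last by exists 0%N.
  have [/existsP [f fP]|/existsPn none] :=
      boolP [exists f : 'I_m, (f \in block m (lo i) (hi i)) && (c <= Defs.val i f)].
    by exists f => _; exists f.
  (* Without such an item, the optimal bundle, worth at least [2 * n * c], would yield [n] blocks
     worth [c], against [MMS I i < c]. *)
  have c_gt0 : 0 < c by apply: le_lt_trans Pi; apply: bigmax_ge_id.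
  move: Pi; rewrite /P ltNge => /negP []; apply: greedy_MMS => //.
  apply: leq_trans (_ : hi i <= m)%N; last by case/andP: (him i).
  apply: leq_trans (iter_first_end_mono _ _ (block_test_worth I i c) (leq0n (lo i))) _.
  apply: small_items_greedy; rewrite ?cE ?him //.
  by move=> e ei; have := none e; rewrite in_block ei /= -ltNge.
pose g i := projT1 (cid (exg i)).
have gP i : P i -> exists2 f : 'I_m, val f = g i &
    (f \in block m (lo i) (hi i)) && (c <= Defs.val i f) := projT2 (cid (exg i)).
pose ok i : rel nat :=
  if P i then fun a b => (a <= g i < b)%N else worth I i (MMS I i).
have [|||||||lo' [hi' [okA disj' cov]]] := @sweep _ m ok P g [set: 'I_n]%SET 0 => //.
- move=> i; rewrite /ok; case: ifP => _; last exact: block_test_worth.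
  by split=> [x y|x x' y|x y y']; lia.
- by move=> i a b; rewrite /ok => ->.
(* Chosen items are distinct because they lie in disjoint optimal bundles. *)
- move=> i j Pi Pj gij; apply/eqP; apply: contraT => /disj /pred0P dis.
  have [f fg /andP [fi _]] := gP _ Pi; have [f' fg' /andP [f'j _]] := gP _ Pj.
  have ff' : f = f' by apply: val_inj; rewrite fg fg'.
  by have := dis f; rewrite /= fi ff' f'j.
- by rewrite -card_gt0 cardsT card_ord.
- by move=> i _ /gP [f <- _] /=.
- by move=> i _ nPi; rewrite cardsT card_ord /ok (negbTE nPi); apply: MMS_greedy.
pose A := [ffun j => block m (lo' j) (hi' j)].
have allocA : @is_allocation R n I A.
  apply: allocation_of_blocks => [j k jk|e em]; first by apply: disj'; rewrite ?inE.
  by have [] := cov e em; move=> j _; exists j.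
have AV i : MMS I i <= bundle_val i (A i) /\ c <= bundle_val i (A i).
  have [_ _] := okA i (finset.in_setT _); rewrite ffunE /ok; case: ifPn => [Pi gi|nPi /andP [_ le_V]].
    have [f fg /andP [_ cf]] := gP _ Pi.
    have fV : c <= bundle_val i (block m (lo' i) (hi' i)).
      by apply: le_trans cf (val_le_bundle _ _); rewrite in_block fg.
    by split=> //; apply: le_trans fV; apply: ltW.
  by split=> //; apply: le_trans le_V; rewrite leNgt.
exists A; split=> //; first by apply/forallP => i; case: (AV i).
by rewrite -cE ler_pM2l //; apply: le_EW => // i; case: (AV i).
Qed.

Lemma instance_price_le I : (0 < n)%N -> (instance_price I <= (2 * n%:R)%:E)%E.
Proof.
move=> n_gt0; have [A [allocA fairA le_OPT]] := fair_allocation I n_gt0.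
have n1 : 1 <= n%:R :> R by rewrite ler1n.
apply: (@le_trans _ _ (Defs.ratio (OPT I) (EW A))).
  by apply: bigmin_le_cond; rewrite allocA.
rewrite /Defs.ratio; have [EW0|EWn0] := eqVneq.
  (* Zero welfare forces a zero optimum, so the ratio is 1 by convention. *)
  have -> : OPT I = 0 by apply: le_anti; rewrite OPT_ge0 (le_trans le_OPT) // EW0 mulr0.
  by rewrite eqxx lee_fin; lra.
by rewrite lee_fin ler_pdivrMr // lt_neqAle eq_sym EWn0 EW_ge0.
Qed.

End Allocations.

(** * The hard instance *)

Section LowerBound.
Context (R : realType) (n : nat) (n_ge3 : (3 <= n)%N).

(* The items come in [n] pairs, each worth [1/n] to a rich agent. In the first
   [pair_count] pairs the even item carries all of this value; item [1] is the
   one that the two poor agents covet. *)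
Definition pair_count : nat := n./2.+1.

Definition rich_val (e : nat) : R :=
  if (e < pair_count.*2)%N then (if odd e then 0 else n%:R^-1)
  else (n.*2)%:R^-1.

(** The factor [1/n] relative to [rich_val] is what turns a bound on rich value into a stronger one
    on poor value. *)
Definition small_val (e : nat) : R :=
  if (e < pair_count.*2)%N then rich_val e / n%:R else 0.

(** Item 1 absorbs the remainder that normalizes the total to 1; it is worth 0 to the rich
    agents. *)
Definition poor_val (e : nat) : R :=
  small_val e + (if e == 1%N then 1 - \sum_(0 <= e' < n.*2) small_val e' else 0).

Definition hard_val (i : 'I_n) (e : 'I_n.*2) : R :=
  if (i < 2)%N then poor_val e else rich_val e.

Lemma n_gt0R : 0 < n%:R :> R.
Proof. rewrite ltr0n; lia. Qed.

Lemma rich_val_ge0 e : 0 <= rich_val e.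
Proof. by rewrite /rich_val; do 2?case: ifP => _ //; rewrite invr_ge0. Qed.

Lemma rich_val_pair k : rich_val k.*2 + rich_val k.*2.+1 = n%:R^-1.
Proof.
rewrite /rich_val ltn_double ltn_Sdouble /= odd_double /=.
case: ifP => _; first by rewrite addr0.
rewrite -muln2 natrM; field.
by rewrite gt_eqF // n_gt0R.
Qed.

Lemma rich_val_pairs c d : (c <= d)%N ->
  \sum_(c.*2 <= e < d.*2) rich_val e = (d - c)%:R / n%:R.
Proof.
elim: d => [|d IHd]; first by rewrite leqn0 => /eqP ->; rewrite big_geq // mul0r.
rewrite leq_eqVlt => /orP [/eqP ->|lecd]; first by rewrite big_geq // subnn mul0r.
rewrite doubleS !big_nat_recr ?IHd; try lia.
by rewrite /= -addrA rich_val_pair subSn // -[(d - c).+1]addn1 natrD mulrDl mul1r.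
Qed.

Lemma rich_val_total : \sum_(0 <= e < n.*2) rich_val e = 1.
Proof. by rewrite (@rich_val_pairs 0 n) // subn0 divff // gt_eqF // n_gt0R. Qed.

Lemma small_val_ge0 e : 0 <= small_val e.
Proof. by rewrite /small_val; case: ifP => _ //; rewrite divr_ge0 ?rich_val_ge0. Qed.

Lemma small_val_le e : small_val e <= rich_val e / n%:R.
Proof. by rewrite /small_val; case: ifP => _ //; rewrite divr_ge0 ?rich_val_ge0. Qed.

Lemma small_val_total : \sum_(0 <= e < n.*2) small_val e <= n%:R^-1.
Proof.
apply: (@le_trans _ _ (\sum_(0 <= e < n.*2) rich_val e / n%:R)).
  by apply: ler_sum => e _; apply: small_val_le.
by rewrite -mulr_suml rich_val_total mul1r.
Qed.

Lemma invn_le : n%:R^-1 <= 3^-1 :> R.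
Proof. by rewrite lef_pV2 ?posrE ?n_gt0R // ler_nat. Qed.

Lemma poor_val_ge0 e : 0 <= poor_val e.
Proof.
rewrite addr_ge0 ?small_val_ge0 //; case: ifP => // _.
have := small_val_total; have := invn_le; lra.
Qed.

Lemma poor_val_total : \sum_(0 <= e < n.*2) poor_val e = 1.
Proof.
have at1 (c : R) : \sum_(0 <= e < n.*2) (if e == 1%N then c else 0) = c.
  by rewrite -big_mkcond (big_nat1_eq +%R (fun=> c)) ifT //; lia.
by rewrite big_split /= at1 addrC subrK.
Qed.

Lemma hard_val_ge0 i e : 0 <= hard_val i e.
Proof. by rewrite /hard_val; case: ifP; rewrite ?poor_val_ge0 ?rich_val_ge0. Qed.

Lemma hard_val_sum1 i : \sum_(e < n.*2) hard_val i e = 1.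
Proof.
have [i2|i2] := boolP (i < 2)%N; under eq_bigr do rewrite /hard_val ?i2 ?(negbTE i2).
  by have := poor_val_total; rewrite big_mkord.
by have := rich_val_total; rewrite big_mkord.
Qed.

Definition hard_instance : instance R n := Instance hard_val_ge0 hard_val_sum1.
Let I := hard_instance.

(** * Optimum and fair allocations of the hard instance *)

Lemma sum_block (F : nat -> R) a b : (b <= n.*2)%N ->
  \sum_(e in block n.*2 a b) F e = \sum_(a <= e < b) F e.
Proof.
move=> bm; rewrite big_geq_mkord (big_ord_widen_cond _ (fun e => a <= e)%N F bm).
by apply: eq_bigl => e; rewrite in_block.
Qed.

Lemma hard_rich (i : 'I_n) (S : bundle I) :
  (2 <= i)%N -> bundle_val i S = \sum_(e in S) rich_val e.
Proof. by move=> i2; apply: eq_bigr => e _; rewrite /= /hard_val ltnNge i2. Qed.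

Lemma hard_poor (i : 'I_n) (S : bundle I) :
  (i < 2)%N -> bundle_val i S = \sum_(e in S) poor_val e.
Proof. by move=> i2; apply: eq_bigr => e _; rewrite /= /hard_val i2. Qed.

Lemma hard_MMS (i : 'I_n) : (2 <= i)%N -> n%:R^-1 <= MMS I i.
Proof.
move=> i2; have := invn_le => n3.
have alloc : @is_allocation R n I [ffun j : 'I_n => block n.*2 j.*2 j.+1.*2].
  apply: allocation_of_blocks => [j k|e /= em].
    by rewrite -val_eqE /=; lia.
  have e2 : (e./2 < n)%N by lia.
  by exists (Ordinal e2) => /=; lia.
apply: (le_MMS alloc); first lra.
move=> j; rewrite hard_rich // ffunE sum_block; last by rewrite leq_double.
by rewrite rich_val_pairs // subSnn mul1r.
Qed.

Lemma hard_OPT : (3 * n%:R)^-1 <= OPT I.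
Proof.
have n0 := n_gt0R.
have third : (3 * n%:R)^-1 = n%:R^-1 / 3 :> R by field; rewrite gt_eqF.
have n3 := invn_le; have ni0 : 0 < n%:R^-1 :> R by rewrite invr_gt0.
(* Agent 0 gets the first pair, with item 1; agent 1 the other pairs among the first [pair_count];
   each rich agent one further item, the last agent also all leftovers. *)
pose lo (i : 'I_n) : nat :=
  (if i == 0 :> nat then 0 else if i == 1 :> nat then 2
   else pair_count.*2 + (i - 2))%N.
pose hi (i : 'I_n) : nat :=
  (if i == 0 :> nat then 2 else if i == 1 :> nat then pair_count.*2
   else if i == n.-1 :> nat then n.*2 else (pair_count.*2 + (i - 2)).+1)%N.
have countE : pair_count = n./2.+1 by [].
have alloc : @is_allocation R n I [ffun j : 'I_n => block n.*2 (lo j) (hi j)].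
  apply: allocation_of_blocks => [j k|e /= em].
    rewrite -val_eqE /= /lo /hi; have := ltn_ord j; have := ltn_ord k.
    by do !case: eqP; lia.
  have [e2|e2] := ltnP e 2.
    have lt0 : (0 < n)%N by lia.
    by exists (Ordinal lt0); rewrite /lo /hi.
  have [ea|ea] := ltnP e pair_count.*2.
    have lt1 : (1 < n)%N by lia.
    by exists (Ordinal lt1); rewrite /lo /hi /=; lia.
  have ltk : (minn (e - pair_count.*2 + 2) n.-1 < n)%N by lia.
  by exists (Ordinal ltk); rewrite /lo /hi /=; do !case: eqP; lia.
apply: le_trans (EW_le_OPT alloc); apply: le_EW => [|i]; first lra.
have him : (hi i <= n.*2)%N by rewrite /hi; have := ltn_ord i; do !case: eqP; lia.
rewrite ffunE third; have [i0|i0] := eqVneq (i : nat) 0%N.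
  rewrite hard_poor ?i0 // sum_block // /lo /hi i0 /= big_nat_recr // big_nat1 /=.
  have := poor_val_ge0 0; have := small_val_ge0 1; have := small_val_total.
  by rewrite {3}/poor_val eqxx; lra.
have [i1|i1] := eqVneq (i : nat) 1%N.
  rewrite hard_poor ?i1 // sum_block // /lo /hi i1 /=.
  apply: (@le_trans _ _ (\sum_(2 <= e < pair_count.*2) rich_val e / n%:R)).
    rewrite -mulr_suml (@rich_val_pairs 1 pair_count) // subn1 /=.
    (* Agent 1 holds [n./2] items worth [1/n^2] each; the constant 3 is tight here at [n = 3]. *)
    have half : 1 <= 3 * n./2%:R / n%:R :> R.
      by rewrite ler_pdivlMr // mul1r -natrM ler_nat; lia.
    have := ler_wpM2r (ltW ni0) half; lra.
  rewrite [leLHS]big_nat_cond [leRHS]big_nat_cond; apply: ler_sum => e.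
  rewrite andbT /poor_val /small_val => /andP [e2 ->]; rewrite ifF ?addr0 //; lia.
have i2 : (2 <= i)%N by lia.
rewrite hard_rich // sum_block // big_ltn; last first.
  by rewrite /lo /hi; have := ltn_ord i; do !case: eqP; lia.
rewrite /rich_val ifN; last by rewrite /lo; do !case: eqP; lia.
set s := \sum_(_ <= _ < _) _; have : 0 <= s by apply: sumr_ge0 => e _; apply: rich_val_ge0.
rewrite -muln2 natrM invfM; lra.
Qed.

(** Measured by [rich_val], the total is 1 and fairness gives each of the [n - 2] rich agents at
    least [1/n]. *)
Lemma hard_poor_share (A : {ffun 'I_n -> bundle I}) (p : 'I_n) :
    is_allocation A -> mms_fair A -> (p < 2)%N ->
  \sum_(e in A p) rich_val e <= 2 / n%:R.
Proof.
move=> /and3P [_ /forallP disj /eqP cover] /forallP fair p2.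
(* Indexing by [nat], with [p] as default out of range, lets the two poor terms be split off the
   sum. *)
pose F (i : nat) := \sum_(e in A (insubd p i)) rich_val e.
have FE (i : 'I_n) : F i = \sum_(e in A i) rich_val e by rewrite /F valKd.
have F_ge0 i : 0 <= F i by apply: sumr_ge0 => e _; apply: rich_val_ge0.
have F_sum : \sum_(0 <= i < n) F i = 1.
  rewrite big_mkord -rich_val_total big_mkord.
  under eq_bigr do rewrite FE.
  rewrite -partition_disjoint_bigcup => [|i j].
    by rewrite cover; apply: eq_bigl => e; rewrite inE.
  by have /forallP /(_ j) /implyP := disj i; apply.
have F_rich i : (2 <= i < n)%N -> n%:R^-1 <= F i.
  case/andP=> i2 ltin; rewrite (FE (Ordinal ltin)) -(@hard_rich (Ordinal ltin)) //.
  exact: le_trans (hard_MMS _) (fair _).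
have rest : (n - 2)%:R / n%:R <= \sum_(2 <= i < n) F i.
  apply: (@le_trans _ _ (\sum_(2 <= i < n) n%:R^-1)).
    by rewrite sumr_const_nat mulr_natl.
  by rewrite [leLHS]big_nat_cond [leRHS]big_nat_cond; apply: ler_sum => i;
     rewrite andbT; apply: F_rich.
move: F_sum; rewrite big_ltn; last lia.
rewrite big_ltn; last lia.
move: rest; have -> : (n - 2)%:R / n%:R = 1 - 2 / n%:R :> R.
  rewrite natrB; last lia.
  by rewrite mulrBl divff // gt_eqF // n_gt0R.
rewrite -FE; have := F_ge0 0%N; have := F_ge0 1%N.
by case: (p : nat) p2 => [|[|//]] _; lra.
Qed.

(** One of the two poor agents misses item 1, and away from item 1 [poor_val] is at most
    [rich_val / n]. *)
Lemma hard_EW (A : {ffun 'I_n -> bundle I}) :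
  is_allocation A -> mms_fair A -> EW A <= 2 / n%:R / n%:R.
Proof.
move=> allocA fairA; have /and3P [_ /forallP disj _] := allocA.
have lt0 : (0 < n)%N by lia.
have lt1 : (1 < n)%N by lia.
have lt2n : (1 < n.*2)%N by lia.
have [p p2 notin] : exists2 p : 'I_n, (p < 2)%N & Ordinal lt2n \notin A p.
  have [in0|] := boolP (Ordinal lt2n \in A (Ordinal lt0)); last by exists (Ordinal lt0).
  exists (Ordinal lt1) => //; apply/negP => in1.
  have /forallP /(_ (Ordinal lt1)) /implyP /(_ isT) /pred0P := disj (Ordinal lt0).
  by move/(_ (Ordinal lt2n)); rewrite /= in0 in1.
apply: le_trans (EW_le A p) _; rewrite hard_poor //.
apply: (@le_trans _ _ ((\sum_(e in A p) rich_val e) / n%:R)); last first.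
  by rewrite ler_pM2r ?invr_gt0 ?n_gt0R //; apply: hard_poor_share.
rewrite mulr_suml; apply: ler_sum => e eA.
rewrite /poor_val ifF ?addr0 ?small_val_le //; apply/eqP => e1.
by move/negP: notin; apply; rewrite (_ : Ordinal _ = e) //; apply: val_inj.
Qed.

Lemma hard_price : ((6^-1 * n%:R)%:E <= instance_price I)%E.
Proof.
have n0 := n_gt0R; apply: le_bigmin => [|A /andP [allocA fairA]]; first by rewrite leey.
have opt := hard_OPT; have ew := hard_EW allocA fairA.
have opt_gt0 : 0 < OPT I by apply: lt_le_trans opt; rewrite invr_gt0 mulr_gt0.
rewrite /Defs.ratio; case: eqVneq => [_|EWn0]; first by rewrite gt_eqF // leey.
have EW_gt0 : 0 < EW A by rewrite lt_neqAle eq_sym EWn0 EW_ge0.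
rewrite lee_fin ler_pdivlMr //; apply: le_trans opt.
(* The constant 6 is the quotient of [1/(3n)] by [2/n^2], which equals [n/6]. *)
apply: (@le_trans _ _ (6^-1 * n%:R * (2 / n%:R / n%:R))).
  by rewrite ler_pM2l // mulr_gt0.
by rewrite le_eqVlt; apply/orP; left; apply/eqP; field; rewrite gt_eqF.
Qed.

End LowerBound.

Theorem theorem11 (R : realType) :
  exists c C : R, [/\ 0 < c, 0 < C &
    forall n : nat, (3 <= n)%N ->
      ((c * n%:R)%:E <= PoF R n)%E /\ (PoF R n <= (C * n%:R)%:E)%E].
Proof.
exists 6^-1, 2; split=> [||n n3]; [by rewrite invr_gt0 | by [] | split].
  apply: le_trans (hard_price R n3) _.
  by apply: ereal_sup_ubound; exists (hard_instance R n3).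
by apply: ge_ereal_sup => _ [I _ <-]; apply: instance_price_le; lia.
Qed.
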